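(* If a Moore graph $\Gamma$ of diameter two and degree $57$ exists, then its automorphism group $\operatorname{Aut}(\Gamma)$ has odd order.
   Context: Graphs are finite, simple and undirected. A Moore graph of diameter two and degree $57$ is a $57$-regular graph of diameter two on $1+57^2=3250$ vertices; equivalently, a strongly regular graph with parameters $(3250,57,0,1)$: a $57$-regular graph on $3250$ vertices in which any two adjacent vertices have no common neighbour and any two distinct non-adjacent vertices have exactly one common neighbour. *)

(* Defs.v *)
From mathcomp Require Import all_boot all_fingroup.
Set Implicit Arguments.
Unset Strict Implicit.
Unset Printing Implicit Defensive.

Definition simple_graph (T : finType) (e : rel T) : Prop :=
  symmetric e /\ irreflexive e.

Definition regular (T : finType) (e : rel T) (k : nat) : Prop :=
  forall x, #|[set y | e x y]| = k.

Definition dist_le (T : finType) (e : rel T) (n : nat) (x y : T) : Prop :=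
  exists p : seq T, [/\ path e x p, last x p = y & size p <= n].

(* The maximum of the distances is attained and equals d; in particular the
   graph is nonempty and connected. *)
Definition has_diameter (T : finType) (e : rel T) (d : nat) : Prop :=
  (forall x y, dist_le e d x y) /\
  (exists x y, forall n, n < d -> ~ dist_le e n x y).

Definition moore_graph_diam2 (T : finType) (e : rel T) (k : nat) : Prop :=
  [/\ simple_graph e, regular e k, has_diameter e 2 & #|T| = 1 + k ^ 2].

Definition graph_aut (T : finType) (e : rel T) : {set {perm T}} :=
  [set s : {perm T} | [forall x, forall y, e (s x) (s y) == e x y]].

Lemma graph_autP (T : finType) (e : rel T) (s : {perm T}) :
  reflect (forall x y, e (s x) (s y) = e x y) (s \in graph_aut e).
Proof.
rewrite inE; apply: (iffP forallP) => [H x y | H x].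
  exact/eqP/(forallP (H x)).
by apply/forallP => y; rewrite H.
Qed.

Lemma graph_aut_group_set (T : finType) (e : rel T) : group_set (graph_aut e).
Proof.
apply/group_setP; split; first by apply/graph_autP => x y; rewrite !perm1.
move=> s t /graph_autP Hs /graph_autP Ht.
by apply/graph_autP => x y; rewrite !permM Ht Hs.
Qed.

Canonical graph_aut_group (T : finType) (e : rel T) : {group {perm T}} :=
  Group (graph_aut_group_set e).

(* Main.v *)
Require Import Defs.
From mathcomp Require Import all_boot all_fingroup.
From mathcomp Require Import pgroup zify.

Set Implicit Arguments.
Unset Strict Implicit.
Unset Printing Implicit Defensive.

(** If the automorphism group had even order it would contain an involution
    [t], by Cauchy's theorem. Let [F] be the set of fixed vertices of [t] and
    [A] the adjacency matrix. The contradiction comes from evaluating the number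
    of walks of length [m = 2 ^ k] that lead from a vertex [x] to [t x], summed
    over [x], that is, the trace of [A ^ m] times the permutation matrix of [t],
    in two ways modulo [2 * m].

    On the one hand, write such a walk as [(v_0, ..., v_(m-1), t v_0)] and send
    it to [(v_1, ..., v_(m-1), t v_0, t v_1)]. The [m]-th iterate of this map
    applies [t] to every vertex, so the map has order dividing [2 * m], a power
    of two, and every orbit has exactly [2 * m] elements except those of walks
    that are fixed pointwise by [t]. Hence the count is congruent to the number
    of closed walks of length [m] inside [F] ([walks_twisted_mod]).

    On the other hand, [A ^ 2 + A = 56 I + J] for a Moore graph of degree 57
    ([moore_common]), so [A ^ m] is a combination of [A], [I] and [J], and the
    count is determined by the number of vertices adjacent to their image and
    the number of fixed vertices ([walks_comboP]).

    It remains to know [F] ([involution_fixes_star]): it induces a star, either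
    with 56 vertices, and then 112 vertices are adjacent to their image, or with
    58 vertices, and then none is. A star with [r] leaves has [2 * r ^ (m / 2)]
    closed walks of length [m]. For [m = 128] and modulo 256 this is 2 in both
    cases, whereas the other evaluation gives 34 and 130.

    The reason behind these numbers is that [A ^ (2 ^ k)] converges 2-adically
    to the projection onto the sum of the eigenspaces of the odd eigenvalues 57
    and 7. Its trace against [t] would have to be the same for the graph and for
    the star, where it is 2. Computed from the numbers of fixed vertices and of
    vertices adjacent to their image it is 34 for a star with 56 vertices, and
    138 / 5 for one with 58 vertices; the latter differs from 2 by 128 / 5, so
    that no smaller power of two than 256 tells it apart from 2. *)

(** * Orbits of a map of prime power order *)

Lemma order_dvdn_iter (T : finType) (f : T -> T) (n : nat) (x : T) :
  injective f -> iter n f x = x -> fingraph.order f x %| n.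
Proof.
move=> f_inj fnx; have o_gt0 := fingraph.order_gt0 f x.
have fq q : iter (q * fingraph.order f x) f x = x.
  by elim: q => // q IHq; rewrite mulSn iterD IHq (fingraph.iter_order f_inj).
have fr : iter (n %% fingraph.order f x) f x = x.
  by rewrite -[RHS]fnx [in RHS](divn_eq n (fingraph.order f x)) addnC iterD fq.
have := findex_iter (ltn_pmod n o_gt0).
by rewrite fr findex0 /dvdn => <-.
Qed.

(** A point not fixed by the [p ^ k]-th iterate has an orbit whose size divides
    [p ^ k.+1] but not [p ^ k], hence of full size [p ^ k.+1]. *)
Lemma card_iter_fix_mod (T : finType) (f : T -> T) (A : {set T}) (p k : nat) :
    prime p -> injective f -> (forall x, x \in A -> f x \in A) ->
    (forall x, iter (p ^ k.+1) f x = x) ->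
  #|A| = #|[set x in A | iter (p ^ k) f x == x]| %[mod p ^ k.+1].
Proof.
move=> p_pr f_inj fA fpk.
pose B := [set x in A | iter (p ^ k) f x != x].
have fAE x : (f x \in A) = (x \in A).
  apply/idP/idP=> [fxA|]; last exact: fA.
  have -> : x = iter (p ^ k.+1).-1 f (f x).
    by rewrite -iterSr prednK ?expn_gt0 ?prime_gt0 ?fpk.
  by elim: (_.-1) => //= n; apply: fA.
have fB : fclosed f B.
  move=> x y /eqP<-; rewrite !inE fAE; congr (_ && ~~ _).
  by rewrite -iterSr iterS (inj_eq f_inj).
have oB : B \subset fingraph.order_set f (p ^ k.+1).
  apply/subsetP=> x; rewrite !inE => /andP[_ fpx].
  have /dvdn_pfactor : fingraph.order f x %| p ^ k.+1 by apply: order_dvdn_iter.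
  case=> // j; rewrite leq_eqVlt => /orP[/eqP-> -> //|lt_jk o_x].
  case/negP: fpx; apply/eqP; have /dvdnP[q ->] : fingraph.order f x %| p ^ k.
    by rewrite o_x dvdn_exp2l.
  by elim: q => // q IHq; rewrite mulSn iterD IHq (fingraph.iter_order f_inj).
rewrite -(cardsID [set x | iter (p ^ k) f x == x] A).
have -> : A :\: [set x | iter (p ^ k) f x == x] = B.
  by apply/setP=> x; rewrite !inE andbC.
have -> : A :&: [set x | iter (p ^ k) f x == x]
        = [set x in A | iter (p ^ k) f x == x].
  by apply/setP=> x; rewrite !inE.
by rewrite -(fcard_order_set f_inj oB fB) addnC modnMDl.
Qed.

(** * Closed walks twisted by an involution *)

Fixpoint walks (T : finType) (a : rel T) (n : nat) (x y : T) : nat :=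
  if n is n'.+1 then \sum_(z | a x z) walks a n' z y else x == y.

Lemma sum_tupleS (T : finType) (n : nat) (F : n.+1.-tuple T -> nat) :
  \sum_(s : n.+1.-tuple T) F s
    = \sum_(x : T) \sum_(p : n.-tuple T) F (cons_tuple x p).
Proof.
rewrite pair_big /= (reindex (fun q : T * n.-tuple T => cons_tuple q.1 q.2)) //=.
exists (fun s => (thead s, behead_tuple s)) => [[x p] _|s _] /=.
  by congr pair; apply: val_inj.
by rewrite [RHS](tuple_eta s); apply: val_inj.
Qed.

Lemma card_paths (T : finType) (a : rel T) (n : nat) (x y : T) :
  \sum_(p : n.-tuple T) path a x (rcons p y) = walks a n.+1 x y.
Proof.
elim: n x => [|n IHn] x.
  rewrite (big_pred1 [tuple]) => [|p]; last exact/esym/eqP/tuple0.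
  rewrite /= andbT; case: (boolP (a x y)) => axy.
    rewrite (bigD1 y) //= eqxx big1 // => z /andP[_ /negPf-> //].
  rewrite big1 // => z axz; case: eqP axz axy => // -> -> //.
rewrite sum_tupleS /= [RHS]big_mkcond /=; apply: eq_bigr => z _.
case: (boolP (a x z)) => axz /=; last by rewrite big1.
by rewrite IHn.
Qed.

Section TwistedWalks.

Variables (T : finType) (a : rel T) (t : {perm T}).
Hypothesis a_t : forall x y, a (t x) (t y) = a x y.
Hypothesis tK : involutive t.

(** The list [s] stands for the walk that visits its entries and then ends at the
    image under [t] of its first entry, so its length is the size of [s]. *)
Definition twisted_walk (s : seq T) : bool :=
  if s is x :: p then path a x (rcons p (t x)) else true.

Definition twisted_rot (s : seq T) : seq T :=
  if s is x :: p then rcons p (t x) else [::].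

Lemma size_twisted_rot n (s : n.-tuple T) : size (twisted_rot s) == n.
Proof. by case: s => -[|x p] //= /eqP <-; rewrite size_rcons. Qed.

Definition rot_tuple n (s : n.-tuple T) : n.-tuple T := Tuple (size_twisted_rot s).

Lemma val_iter_rot n j (s : n.-tuple T) :
  iter j (@rot_tuple n) s = iter j twisted_rot s :> seq T.
Proof. by elim: j => //= j ->. Qed.

Lemma iter_twisted_rot_cat s1 s2 :
  iter (size s1) twisted_rot (s1 ++ s2) = s2 ++ map t s1.
Proof.
elim: s1 s2 => [|x s1 IHs] s2; first by rewrite cats0.
by rewrite /= -iterS iterSr /= -cats1 -catA IHs -catA.
Qed.

Lemma iter_rot_map n (s : n.-tuple T) :
  iter n (@rot_tuple n) s = map_tuple t s.
Proof.
apply: val_inj; rewrite /= val_iter_rot.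
by rewrite -[X in iter X](size_tuple s) -[X in iter _ _ X]cats0 iter_twisted_rot_cat.
Qed.

Lemma rot_tuple_inj n : injective (@rot_tuple n).
Proof.
case=> [[|x p] sp] [[|y q] sq] /(congr1 val) /= eq_pq; apply: val_inj => //=.
- by move/(congr1 size): eq_pq; rewrite size_rcons.
- by move/(congr1 size): eq_pq; rewrite size_rcons.
by have /rcons_inj[-> /perm_inj->] := eq_pq.
Qed.

Lemma twisted_walk_rot s : twisted_walk s -> twisted_walk (twisted_rot s).
Proof.
case: s => [|x [|y p]] //=; first by rewrite a_t.
by rewrite !rcons_path last_rcons a_t => /andP[-> /andP[-> ->]].
Qed.

Lemma card_twisted_walks n :
  #|[set s : n.+1.-tuple T | twisted_walk s]| = \sum_x walks a n.+1 x (t x).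
Proof.
rewrite cardsE -sum1_card big_mkcond sum_tupleS; apply: eq_bigr => x _.
rewrite -card_paths; apply: eq_bigr => p _.
by rewrite unfold_in /=; case: ifP.
Qed.

Definition fix_rel : rel T := [rel x y | [&& a x y, t x == x & t y == y]].

(** The one-vertex path is set apart: [fix_rel] constrains the ends of edges only. *)
Lemma path_fix_rel x p :
  path fix_rel x p = path a x p && ((p == [::]) || all (fun z => t z == z) (x :: p)).
Proof.
elim: p x => //= y p IHp x; rewrite IHp /fix_rel /=.
by case: (a x y); case: (t x == x); case: (path a y p);
  case: p {IHp} => [|z p] /=; case: (t y == y).
Qed.

(** The rotation of twisted walks of length [2 ^ k] has order dividing [2 ^ k.+1],
    since going once around applies [t] to all vertices; the walks fixed by its
    [2 ^ k]-th iterate are those whose vertices are all fixed by [t]. *)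
Lemma walks_twisted_mod k :
  \sum_x walks a (2 ^ k) x (t x)
    = \sum_x walks fix_rel (2 ^ k) x x %[mod 2 ^ k.+1].
Proof.
have [n def_n] : {n | 2 ^ k = n.+1} by exists (2 ^ k).-1; rewrite prednK ?expn_gt0.
rewrite def_n -card_twisted_walks.
rewrite (@card_iter_fix_mod _ (@rot_tuple n.+1) _ 2 k) //; first last.
- move=> s; rewrite expnS mul2n -addnn iterD def_n !iter_rot_map.
  by apply: val_inj; rewrite /= -map_comp map_id_in // => x _ /=.
- by move=> s; rewrite !inE; apply: twisted_walk_rot.
- exact: rot_tuple_inj.
congr (_ %% _); rewrite cardsE -sum1_card big_mkcond sum_tupleS.
apply: eq_bigr => x _; rewrite -card_paths; apply: eq_bigr => p _.
rewrite unfold_in inE def_n iter_rot_map path_fix_rel -(inj_eq val_inj) /=.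
have -> : rcons p x == [::] = false by case: (val p).
rewrite all_rcons eqseq_cons.
have -> : ([seq t i | i <- p] == p :> seq T) = all (fun z => t z == z) p.
  by elim: (val p) => //= z q <-; rewrite eqseq_cons.
case: eqP => [->|]; last by rewrite !andbF.
by rewrite /=; case: (_ && _).
Qed.

End TwistedWalks.

(** * Common neighbours in a Moore graph *)

Section MooreGraph.

Variables (T : finType) (e : rel T) (k : nat).
Hypothesis hG : moore_graph_diam2 e k.

Let e_sym : symmetric e. Proof. by case: hG => -[]. Qed.
Let e_irr : irreflexive e. Proof. by case: hG => -[]. Qed.

Lemma moore_deg x : \sum_(z | e x z) 1 = k.
Proof. by case: hG => _ reg _ _; rewrite -(reg x) sum1dep_card. Qed.

Lemma moore_common_exists x y :
  x != y -> ~~ e x y -> exists2 z, e x z & e z y.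
Proof.
case: hG => _ _ [diam _] _; have [p [xp lp]] := diam x y.
case: p xp lp => [_ /= ->|z [|z' [|//]]] /=; rewrite ?eqxx //.
- by rewrite andbT => exz <- _ _; rewrite exz.
by rewrite andbT => /andP[exz ezy] <- _ _ _; exists z.
Qed.

(** There are [k ^ 2] walks of length two from [x], of which [k] return to [x].
    The diameter forces each of the [k ^ 2 - k] other non-neighbours of [x] to be
    the end of one, so none of them is the end of two and no neighbour of [x] is
    the end of any. *)
Lemma moore_common x y :
  \sum_(z | e x z) e z y = if x == y then k else ~~ e x y.
Proof.
have tot : \sum_y \sum_(z | e x z) e z y = k * k.
  rewrite exchange_big /= -{1}(moore_deg x) big_distrl /=.
  apply: eq_bigr => z _; rewrite mul1n -(moore_deg z) [RHS]big_mkcond /=.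
  by apply: eq_bigr => w _; case: (e z w).
have selfE : \sum_(z | e x z) e z x = k.
  by rewrite -[RHS](moore_deg x); apply: eq_bigr => z; rewrite e_sym => ->.
have [<-|neq_xy] := eqVneq x y; first exact: selfE.
have far : \sum_(y | y != x) ~~ e x y + k = k ^ 2.
  case: hG => _ _ _ /eqP; rewrite -sum1_card (bigD1 x) //= eqn_add2l => /eqP <-.
  rewrite -[X in _ + X](moore_deg x) [X in _ + X]big_mkcond [X in _ + X](bigD1 x) //=.
  rewrite e_irr add0n -big_split; apply: eq_bigr => z _ /=.
  by case: (e x z).
have le_c z : z != x ->
    ~~ e x z <= \sum_(w | e x w) e w z
      ?= iff ((~~ e x z : nat) == \sum_(w | e x w) e w z).
  move=> zx; split=> //; case: (boolP (e x z)) => //= nexz.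
  have [|w exw ewz] := @moore_common_exists x z _ nexz; first by rewrite eq_sym.
  by rewrite (bigD1 w) //= ewz.
have [_ /esym] := leqif_sum le_c.
rewrite (_ : (_ == _) = true).
  by move/forall_inP=> /(_ y); rewrite eq_sym neq_xy => /(_ isT) /eqP <-.
apply/eqP; move: tot; rewrite (bigD1 x) //= selfE; lia.
Qed.

Lemma moore_triangle_free x y z : e x y -> e y z -> ~~ e x z.
Proof.
move=> exy eyz; apply/negP => exz; have := moore_common x z.
have -> : x == z = false by apply/eqP=> xz; move: exz; rewrite xz e_irr.
by rewrite exz (bigD1 y) //= eyz.
Qed.

Lemma moore_common_uniq x y z w :
  x != y -> e x z -> e z y -> e x w -> e w y -> z = w.
Proof.
move=> neq_xy exz ezy exw ewy; apply/eqP; apply/negPn/negP => neq_zw.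
have := moore_common x y; rewrite (negPf neq_xy) (bigD1 z) //= (bigD1 w) /=.
  by rewrite ezy ewy; case: (e x y).
by rewrite exw eq_sym.
Qed.

(** * Counting walks *)

(** The passage from [p A + q I + r J] to its product with [A], by means of
    [A ^ 2 = (k - 1) I + J - A] and [A J = k J]; modulo [m], the number [m.-1]
    plays the role of [-1]. *)
Definition walk_coef_step (m : nat) (c : nat * nat * nat) : nat * nat * nat :=
  let: (p, q, r) := c in
  ((q + m.-1 * p) %% m, (k + m.-1) * p %% m, (p + k * r) %% m).

Definition walks_combo (m n : nat) (c : nat * nat * nat) : Prop :=
  forall x y,
    walks e n x y = c.1.1 * e x y + c.1.2 * (x == y) + c.2 %[mod m].

Lemma walks_comboS m n c :
  0 < m -> walks_combo m n c -> walks_combo m n.+1 (walk_coef_step m c).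
Proof.
case: c => [[p q] r] m_gt0 IHn x y.
have -> : walks e n.+1 x y
   = p * (if x == y then k else ~~ e x y) + q * e x y + r * k %[mod m].
  have -> : q * e x y = \sum_(z | e x z) q * (z == y).
    rewrite [RHS]big_mkcond [RHS](bigD1 y) //= eqxx muln1 big1 => [|z /negPf->].
      by case: (e x y); rewrite addn0 ?muln0 ?muln1.
    by rewrite muln0 if_same.
  have -> : r * k = \sum_(z | e x z) r.
    by rewrite -(moore_deg x) big_distrr /=; apply: eq_bigr => z _; rewrite muln1.
  rewrite -moore_common !big_distrr -!big_split /=.
  rewrite -modn_summ -[RHS]modn_summ; congr (_ %% _).
  by apply: eq_bigr => z _; rewrite IHn.
have modE a b d f : a %% m * b + d %% m * f = a * b + d * f %[mod m].
  by rewrite -modnDm !modnMml modnDm.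
rewrite /= modnDmr -[RHS]modnDml modE modnDml.
rewrite -[in LHS](modnMDl (((x == y) || e x y) * p)); congr (_ %% _).
case: (eqVneq x y) => [<-|_]; rewrite ?e_irr; first by nia.
by case: (e x y); nia.
Qed.

Lemma walks_comboP m n :
  0 < m -> walks_combo m n (iter n (walk_coef_step m) (0, 1, 0)).
Proof.
move=> m_gt0; elim: n => [|n IHn]; last exact: walks_comboS.
by move=> x y; rewrite /= addn0 mul1n.
Qed.

(** * The fixed vertices of an involution *)

Section Involution.

Variable t : {perm T}.
Hypothesis e_t : forall x y, e (t x) (t y) = e x y.
Hypothesis tK : involutive t.

Let F := [set x | t x == x].

Definition fdeg (u : T) : nat := \sum_(g in F) e u g.

Let inF x : (x \in F) = (t x == x). Proof. by rewrite inE. Qed.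

Let e_tC x y : e (t x) y = e x (t y).
Proof. by rewrite -{1}(tK y) e_t. Qed.

(** This is [A ^ 2 + A + I = k I + J] applied to the indicator of [F]. *)
Lemma sum_fdeg_nbrs v :
  \sum_(u | e v u) fdeg u + fdeg v + (v \in F) = #|F| + (v \in F) * k.
Proof.
rewrite exchange_big /= -sum1_card.
have -> : (v \in F) = \sum_(g in F) (v == g) :> nat.
  rewrite big_mkcond (bigD1 v) //= eqxx big1 ?addn0; first by case: (v \in F).
  by move=> g /negPf; rewrite eq_sym => ->; rewrite if_same.
rewrite big_distrl -!big_split /=; apply: eq_bigr => g _.
rewrite moore_common; case: eqVneq => [->|_]; first by rewrite e_irr; lia.
by case: (e v g).
Qed.

(** The image under [t] of a common neighbour of [x] and [y] is another one, and
    there is only one. *)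
Lemma fixed_common x y z :
  x \in F -> y \in F -> x != y -> e x z -> e z y -> z \in F.
Proof.
rewrite !inE => /eqP tx /eqP ty neq_xy exz ezy; apply/eqP.
apply: (moore_common_uniq neq_xy) => //; first by rewrite -tx e_t.
by rewrite -ty e_t.
Qed.

(** A fixed neighbour of [u] is a common neighbour of [u] and [t u]. There is none
    if these are adjacent; otherwise there is exactly one common neighbour, and
    [t] fixes it because it exchanges [u] and [t u]. *)
Lemma fdeg_moved u : u \notin F -> fdeg u = ~~ e u (t u).
Proof.
rewrite inE => tu; rewrite /fdeg; case: (boolP (e u (t u))) => eu /=.
  rewrite big1 // => g; rewrite inE => /eqP tg.
  case: (boolP (e u g)) => // eug; have := moore_triangle_free eu.
  by move=> /(_ g); rewrite e_tC tg eug => /(_ isT).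
have [|z euz ezt] := moore_common_exists _ eu; first by rewrite eq_sym.
have Fz : z \in F.
  rewrite inE; apply/eqP; apply: (@moore_common_uniq u (t u)) => //.
  - by rewrite eq_sym.
  - by rewrite -e_tC e_sym.
  - by rewrite e_t e_sym.
rewrite (bigD1 z) //= euz big1 // => g /andP[]; rewrite inE => /eqP tg neq_gz.
case: (boolP (e u g)) => // eug; case/eqP: neq_gz.
apply: (@moore_common_uniq u (t u)) => //; first by rewrite eq_sym.
by rewrite -e_tC tg e_sym.
Qed.

Lemma fixed_nbr_unflipped f u : f \in F -> e f u -> ~~ e u (t u).
Proof.
rewrite inE => /eqP tf efu; apply/negP => eu.
by have := moore_triangle_free efu eu; rewrite -e_tC tf efu.
Qed.

Lemma sum_fdeg_fixed_nbrs f :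
  f \in F -> \sum_(g in F | e f g) fdeg g + 1 = #|F|.
Proof.
move=> Ff; have := sum_fdeg_nbrs f; rewrite Ff mul1n.
rewrite (bigID (mem F)) /= (eq_bigl (fun g => (g \in F) && e f g)); last first.
  by move=> g; rewrite andbC.
have -> : \sum_(u | e f u && (u \notin F)) fdeg u = \sum_(u | e f u && (u \notin F)) 1.
  by apply: eq_bigr => u /andP[efu Fu]; rewrite fdeg_moved // (fixed_nbr_unflipped Ff).
have := moore_deg f; rewrite (bigID (mem F)) /=.
have -> : \sum_(u | e f u && (u \in F)) 1 = fdeg f.
  rewrite /fdeg -big_mkcondr /=; apply: eq_bigl => u; exact: andbC.
lia.
Qed.

Lemma fixed_common_sum x y : x \in F -> y \in F -> x != y ->
  \sum_(z in F | e x z) e z y = ~~ e x y.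
Proof.
move=> Fx Fy neq_xy; have := moore_common x y; rewrite (negPf neq_xy) => <-.
rewrite [RHS](bigID (mem F)) /= [X in _ = _ + X]big1 ?addn0.
  by apply: eq_bigl => z; rewrite andbC.
move=> z /andP[exz nFz]; case: (boolP (e z y)) => // ezy.
by rewrite (fixed_common Fx Fy neq_xy exz ezy) in nFz.
Qed.

(** Count the walks of length three from [f] to [g] inside [F]. A fixed neighbour
    [h] of [f] is followed by exactly one walk of length two to [g], unless [h]
    is the common neighbour of [f] and [g], when it is followed by none; so the
    number of these walks is [fdeg f - 1], and by symmetry [fdeg g - 1]. *)
Lemma fdeg_nonadj f g :
  f \in F -> g \in F -> f != g -> ~~ e f g -> fdeg f = fdeg g.
Proof.
have fdegE x y : x \in F -> y \in F -> x != y -> ~~ e x y ->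
    fdeg x = \sum_(h in F | e x h) \sum_(z in F | e h z) e z y + 1.
  move=> Fx Fy neq_xy nexy.
  have <- : \sum_(z in F | e x z) e z y = 1 by rewrite fixed_common_sum ?nexy.
  rewrite -big_split /= /fdeg big_mkcondr /=.
  apply: eq_bigr => h Fh; case: (boolP (e x h)) => // exh.
  rewrite fixed_common_sum //; first by case: (e h y).
  by apply: contraNneq nexy => <-.
move=> Ff Fg neq_fg nefg; rewrite (fdegE f g) // (fdegE g f) //; first last.
- by rewrite e_sym.
- by rewrite eq_sym.
congr (_ + _).
rewrite (exchange_big_dep (mem F)) /=; last by move=> h z _ /andP[].
rewrite [RHS]big_mkcondr /=; apply: eq_bigr => z Fz.
rewrite (e_sym g z); case: (boolP (e z g)) => ezg; last first.
  by rewrite big1.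
rewrite [LHS]big_mkcond [RHS]big_mkcond /=; apply: eq_bigr => h _.
rewrite Fz /= (e_sym h z) (e_sym h f).
by case: (h \in F); case: (e f h); case: (e z h).
Qed.

(** Vertices of different degrees in [F] are adjacent. If [f] and [g] are such
    vertices, a vertex [h] of [F] not adjacent to [f] has the degree of [f], and
    a vertex [h'] not adjacent to [g] the degree of [g]; then [f, g, h, h'] would
    form a quadrangle. So [f] or [g] is adjacent to all other vertices of [F]. If
    all degrees are equal, [sum_fdeg_fixed_nbrs] gives the number of vertices of
    a Moore graph of that degree. *)
Lemma fixed_star_or_regular :
  (exists2 c, c \in F & forall h, h \in F -> h != c -> e c h)
  \/ (forall f, f \in F -> fdeg f ^ 2 + 1 = #|F|).
Proof.
case: (boolP [forall f in F, [forall g in F, fdeg f == fdeg g]]) => [/forall_inP reg|].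
  right=> f Ff; rewrite -(sum_fdeg_fixed_nbrs Ff).
  have -> : \sum_(g in F | e f g) fdeg g = \sum_(g in F | e f g) fdeg f.
    by apply: eq_bigr => g /andP[Fg _]; have /forall_inP/(_ g Fg)/eqP := reg f Ff.
  congr (_ + _); rewrite -mulnn {2}/fdeg big_distrr big_mkcondr /=.
  by apply: eq_bigr => g _; case: (e f g); rewrite ?muln1 ?muln0.
rewrite negb_forall_in => /exists_inP[f Ff]; rewrite negb_forall_in.
case/exists_inP=> g Fg neq_d; left.
have adj x y : x \in F -> y \in F -> fdeg x != fdeg y -> e x y.
  move=> Fx Fy; apply: contraR => nexy; apply/eqP.
  by case: (eqVneq x y) => [->|neq_xy] //; apply: fdeg_nonadj.
have efg := adj f g Ff Fg neq_d.
case: (boolP [forall (h | (h \in F) && (h != f)), e f h]) => [/forall_inP allf|].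
  by exists f => // h Fh neq_hf; apply: allf; rewrite Fh.
rewrite negb_forall_in => /exists_inP[h /andP[Fh neq_hf] nefh].
exists g => // h' Fh' neq_h'g; apply/negPn/negP => negh'.
have dh : fdeg h = fdeg f by apply/esym/fdeg_nonadj; rewrite // eq_sym.
have dh' : fdeg h' = fdeg g by apply/esym/fdeg_nonadj; rewrite // eq_sym.
have efh' : e f h' by apply: adj; rewrite // dh'.
have eh'h : e h' h by apply: adj; rewrite // dh' dh eq_sym.
have egh : e g h by apply: adj; rewrite // dh eq_sym.
by case/eqP: neq_h'g; apply: (@moore_common_uniq f h) => //; rewrite eq_sym.
Qed.

(** [F] is in bijection with the neighbours of [v] other than [t v]: each of those
    is moved to a non-neighbour, for otherwise it would form a quadrangle with
    [v], [t v] and its image, and so has a single fixed neighbour; and each fixed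
    vertex is reached from [v] through one of them. *)
Lemma card_fixed_flipped v : e v (t v) -> #|F| + 1 = k.
Proof.
move=> ev; have nFv : v \notin F.
  by rewrite inE; apply/eqP => tv; rewrite tv e_irr in ev.
have := sum_fdeg_nbrs v; rewrite (negPf nFv) !addn0 fdeg_moved // ev addn0 => <-.
rewrite -[RHS](moore_deg v) (bigD1 (t v)) //= [in RHS](bigD1 (t v)) //=.
have ntv : t v \notin F by rewrite inE (inj_eq perm_inj) -inF.
rewrite fdeg_moved // e_t ev add0n addnC; congr (_ + _).
apply: eq_bigr => u /andP[evu neq_utv].
have nFu : u \notin F.
  apply/negP => Fu; have := @fixed_nbr_unflipped u v Fu.
  by rewrite e_sym ev => /(_ evu).
rewrite fdeg_moved //; case: (boolP (e u (t u))) => // eu.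
case/eqP: (neq_utv); apply: (@moore_common_uniq v (t u)) => //.
- by apply/eqP => vtu; rewrite vtu tK eqxx in neq_utv.
- by rewrite e_t.
Qed.

(** Through each of the [k - 1] neighbours of [v] other than [f] one reaches one
    fixed vertex, and through [f] its [fdeg f] fixed neighbours; this covers
    every fixed vertex but [f] itself. *)
Lemma card_fixed_unflipped v f : (forall x, ~~ e x (t x)) ->
  v \notin F -> f \in F -> e v f -> #|F| = fdeg f + k.
Proof.
move=> unfl nFv Ff evf; have := sum_fdeg_nbrs v.
rewrite (negPf nFv) !addn0 (fdeg_moved nFv) unfl => <-.
rewrite -[in RHS](moore_deg v) (bigD1 f) //= [in RHS](bigD1 f) //=.
rewrite -addnA [in RHS](addnC 1); congr (_ + (_ + _)).
apply: eq_bigr => u /andP[evu neq_uf]; rewrite fdeg_moved ?unfl //.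
apply/negP => Fu; have := fdeg_moved nFv; rewrite unfl /fdeg.
by rewrite (bigD1 f) //= (bigD1 u) /= ?Fu // evf evu.
Qed.

(** [t] acts on the neighbours of [f] and pairs off the moved ones. *)
Lemma fdeg_odd f : f \in F -> odd (fdeg f) = odd k.
Proof.
rewrite inE => /eqP tf; case: (hG) => _ reg _ _; rewrite -(reg f).
have := @card_iter_fix_mod _ t [set y | e f y] 2 0 isT perm_inj.
have tA x : x \in [set y | e f y] -> t x \in [set y | e f y].
  by rewrite !inE -{2}tf e_t.
move=> /(_ tA (fun x => tK x)) /=.
rewrite expn1 !modn2 => eq_odd; apply: can_inj oddb _ _ _.
rewrite eq_odd; congr (odd _); rewrite /fdeg -big_mkcondr sum1dep_card /=.
by apply: eq_card => y; rewrite !inE andbC.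
Qed.

(** Sum [fdeg] over all vertices: each fixed vertex is seen from its [k]
    neighbours, and a moved vertex contributes one unless it is adjacent to its
    image. *)
Lemma card_flipped :
  k * #|F| + #|F| + \sum_x e x (t x) = \sum_(f in F) fdeg f + #|T|.
Proof.
have tot : k * #|F| = \sum_u fdeg u.
  rewrite exchange_big /= mulnC -sum_nat_const; apply: eq_bigr => g _.
  rewrite -(moore_deg g) big_mkcond /=.
  by apply: eq_bigr => u _; rewrite e_sym; case: (e u g).
have moved : \sum_(u | u \notin F) fdeg u + \sum_x e x (t x) = #|[predC F]|.
  rewrite [X in _ + X](bigID (mem F)) /= [X in _ + (X + _)]big1 => [|f]; last first.
    by rewrite inE => /eqP->; rewrite e_irr.
  rewrite add0n -big_split -sum1_card; apply: eq_big => [x|u nFu] //=.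
  by rewrite fdeg_moved //; case: (e u _).
have cT : #|F| + #|[predC F]| = #|T| := cardC (mem F).
by rewrite tot (bigID (mem F)) /= -cT -moved; lia.
Qed.

End Involution.

End MooreGraph.

(** * Closed walks in a star *)

Section Star.

Variables (T : finType) (a : rel T) (S : {set T}) (c : T).
Hypothesis Sc : c \in S.
Hypothesis starE :
  forall x y, a x y = [&& x \in S, y \in S & (x == c) != (y == c)].

Lemma sum_star_nbrs (G : T -> nat) x :
  \sum_(z | a x z) G z =
    if x == c then \sum_(z in S :\ c) G z else (x \in S) * G c.
Proof.
case: eqVneq => [->|neq_xc].
  by apply: eq_bigl => z; rewrite starE Sc eqxx !inE /= andbC; case: (z == c).
case: (boolP (x \in S)) => [Sx|nSx].
  rewrite (big_pred1 c) ?mul1n // => z.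
  rewrite starE Sx (negPf neq_xc) /=.
  by case: (eqVneq z c) => [->|]; rewrite ?Sc ?andbF.
by rewrite big1 // => z; rewrite starE (negPf nSx).
Qed.

(** The square of the adjacency matrix of the star. *)
Definition star2 (x y : T) : nat :=
  if x == c then #|S :\ c| * (y == c) else (x \in S) * ((y \in S) && (y != c)).

Lemma star_common x y : \sum_(z | a x z) a z y = star2 x y.
Proof.
rewrite sum_star_nbrs /star2; case: eqVneq => _.
  rewrite -[RHS]sum_nat_const; apply: eq_bigr => z.
  rewrite !inE starE => /andP[/negPf-> ->].
  by case: (eqVneq y c) => [->|]; rewrite ?Sc ?andbF.
by rewrite starE Sc eqxx.
Qed.

Lemma sum_star2 x y : \sum_(z | a x z) star2 z y = #|S :\ c| * a x y.
Proof.
rewrite sum_star_nbrs /star2; case: eqVneq => [->|neq_xc].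
  rewrite -[RHS]sum_nat_const; apply: eq_bigr => z; rewrite !inE => /andP[/negPf-> ->].
  by rewrite starE Sc eqxx mul1n.
rewrite eqxx starE (negPf neq_xc); case: (x \in S); rewrite ?muln0 //= mul1n.
by case: (eqVneq y c) => [->|]; rewrite ?Sc ?andbF.
Qed.

(** With [r] leaves the adjacency matrix [A] of the star satisfies [A ^ 3 = r A]. *)
Lemma walks_star n x y : walks a n.*2.+2 x y = #|S :\ c| ^ n * star2 x y.
Proof.
elim: n x y => [|n IHn] x y.
  rewrite mul1n -star_common /=; apply: eq_bigr => z _.
  rewrite big_mkcond (bigD1 y) //= eqxx big1 ?addn0; first by case: (a z y).
  by move=> w /negPf->; rewrite if_same.
have step z : walks a n.*2.+3 z y = #|S :\ c| ^ n.+1 * a z y.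
  rewrite [LHS]/=; under eq_bigr => w _ do rewrite -/(walks a n.*2.+2 w y) IHn.
  by rewrite -big_distrr /= sum_star2 expnSr mulnA.
rewrite doubleS [LHS]/=; under eq_bigr => w _ do rewrite -/(walks a n.*2.+3 w y) step.
by rewrite -big_distrr /= star_common.
Qed.

Lemma closed_walks_star n :
  \sum_x walks a n.*2.+2 x x = 2 * #|S :\ c| ^ n.+1.
Proof.
under eq_bigr => x _ do rewrite walks_star.
rewrite -big_distrr (bigD1 c) //= {1}/star2 eqxx muln1.
rewrite -(@eq_bigr _ _ _ _ _ _ (fun x => (x \in S :\ c) : nat)); last first.
  by move=> x neq_xc; rewrite /star2 (negPf neq_xc) !inE neq_xc andbT; case: (x \in S).
have -> : \sum_(x | x != c) (x \in S :\ c : nat) = #|S :\ c|.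
  rewrite -sum1_card big_mkcond [RHS]big_mkcond; apply: eq_bigr => x _ /=.
  by rewrite !inE; case: (x != c); case: (x \in S).
by rewrite addnn -muln2 expnS; lia.
Qed.

End Star.

(** * Exclusion of involutions *)

Lemma modn_sqr_iter m b n :
  b ^ (2 ^ n) %% m = iter n (fun r => r ^ 2 %% m) (b %% m).
Proof. by elim: n => //= n <-; rewrite modnXm -expnM -expnSr. Qed.

(** If some vertex is adjacent to its image then [F] has 56 vertices, which is not
    of the form [d ^ 2 + 1]. Otherwise [#|F| = d + 57] for the degree [d] in [F]
    of any fixed vertex with a moved neighbour: if [F] were regular then
    [d + 57 = d ^ 2 + 1] would give [d = 8], which is even; and the centre of a
    star has [d = #|F| - 1], so that vertex is a leaf and [#|F| = 58]. *)
Lemma involution_fixes_star (T : finType) (e : rel T) (t : {perm T}) :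
    moore_graph_diam2 e 57 -> (forall x y, e (t x) (t y) = e x y) ->
    involutive t -> t != 1%g ->
  let F := [set x | t x == x] in
  exists2 c, c \in F /\ (forall h, h \in F -> h != c -> e c h)
    & #|F| = 56 /\ \sum_x e x (t x) = 112 \/ #|F| = 58 /\ \sum_x e x (t x) = 0.
Proof.
move=> hG e_t tK t_neq1 F.
have e_sym : symmetric e by case: hG => -[].
have e_irr : irreflexive e by case: hG => -[].
have cardT : #|T| = 3250 by case: hG => _ _ _ ->.
have count := card_flipped hG e_t tK.
have leaf c : c \in F -> (forall h, h \in F -> h != c -> e c h) ->
    forall h, h \in F -> fdeg e t h = if h == c then #|F|.-1 else 1.
  move=> Fc star h Fh; case: eqVneq => [->|neq_hc].
    rewrite (cardsD1 c) Fc /= -sum1_card /fdeg (bigD1 c) //= e_irr add0n.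
    apply: eq_big => [x|x /andP[Fx neq_xc]]; first by rewrite !inE andbC.
    by rewrite star.
  rewrite /fdeg (bigD1 c) //= e_sym star // big1 // => g /andP[Fg neq_gc].
  have ehc : e h c by rewrite e_sym star.
  have := moore_triangle_free hG ehc (star g Fg neq_gc).
  by case: (e h g).
have sum_star c : c \in F -> (forall h, h \in F -> h != c -> e c h) ->
    \sum_(f in F) fdeg e t f = #|F|.-1.*2.
  move=> Fc star; rewrite (bigD1 c) //= (leaf c) // eqxx.
  rewrite (eq_bigr (fun=> 1)) => [|f /andP[Ff /negPf neq_fc]]; last first.
    by rewrite (leaf c) // neq_fc.
  rewrite -addnn; congr (_ + _); rewrite sum1dep_card (cardsD1 c F) Fc /=.
  by apply: eq_card => x; rewrite !inE andbC.
case: (pickP (fun v => e v (t v))) => [v ev | unfl].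
  have cardF := card_fixed_flipped hG e_t tK ev; rewrite -/F in cardF count.
  have [[c Fc star]|reg] := fixed_star_or_regular hG e_t tK; last first.
    have [f Ff] : exists f, f \in F by apply/card_gt0P; rewrite -[#|_|](addnK 1) cardF.
    exfalso; have := reg f Ff; rewrite -/F -mulnn; case: (leqP (fdeg e t f) 7); nia.
  exists c => //; left; have := sum_star c Fc star; rewrite cardT in count.
  lia.
have a1 : \sum_x e x (t x) = 0 by rewrite big1 // => x _; rewrite unfl.
have [v nFv] : exists v, v \notin F.
  apply/existsP; apply: contraR t_neq1; rewrite negb_exists => /forallP tx.
  by apply/eqP/permP => x; rewrite perm1; apply/eqP; move: (tx x); rewrite negbK inE.
have [f /andP[Ff evf]] : exists f, (f \in F) && e v f.
  apply/existsP; have := fdeg_moved hG e_t tK nFv; rewrite unfl.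
  apply: contra_eqT; rewrite negb_exists => /forallP none.
  by rewrite /fdeg big1 // => g Fg; have := none g; rewrite Fg; case: (e v g).
have cardF : #|F| = fdeg e t f + 57.
  by apply: (card_fixed_unflipped hG e_t tK _ nFv Ff evf) => x; rewrite unfl.
have [[c Fc star]|reg] := fixed_star_or_regular hG e_t tK.
  exists c => //; right; split=> //; move: cardF; rewrite (leaf c) //.
  by case: eqP => _; lia.
have odd_d := fdeg_odd hG e_t tK Ff.
have d8 : fdeg e t f = 8.
  by have := reg f Ff; rewrite -/F -mulnn; nia.
by rewrite d8 in odd_d.
Qed.

Lemma no_involution (T : finType) (e : rel T) (t : {perm T}) :
    moore_graph_diam2 e 57 -> (forall x y, e (t x) (t y) = e x y) ->
    involutive t -> t = 1%g.
Proof.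
move=> hG e_t tK; apply/eqP; apply/negPn/negP => t_neq1.
have [c [Fc star] cases] := involution_fixes_star hG e_t tK t_neq1.
set F := [set x | t x == x] in Fc star cases.
have e_sym : symmetric e by case: hG => -[].
have e_irr : irreflexive e by case: hG => -[].
have starE x y : fix_rel e t x y = [&& x \in F, y \in F & (x == c) != (y == c)].
  rewrite /fix_rel /= !inE; case: (boolP (t x == x)) => Fx; last by rewrite andbF.
  case: (boolP (t y == y)) => Fy; last by rewrite !andbF.
  rewrite !andbT /=; case: (eqVneq x c) => [->|neq_xc].
    case: (eqVneq y c) => [->|neq_yc]; first by rewrite e_irr.
    by rewrite star ?inE.
  case: (eqVneq y c) => [->|neq_yc]; first by rewrite e_sym star ?inE.
  apply/negbTE; apply: (moore_triangle_free hG (y := c)); last by rewrite star ?inE.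
  by rewrite e_sym star ?inE.
have := walks_twisted_mod e_t tK 7.
(* The length [63.*2.+2] is [2 ^ 7]. *)
rewrite (closed_walks_star Fc starE 63).
have -> : #|F :\ c| = #|F|.-1 by rewrite (cardsD1 c F) Fc.
have combo := @walks_comboP _ _ _ hG 256 128 isT.
(* [A ^ 128] is [239 A + 120 I + 209 J] modulo 256. *)
have coef : iter 128 (walk_coef_step 57 256) (0, 1, 0) = (239, 120, 209).
  by vm_compute.
rewrite coef in combo.
have -> : \sum_x walks e (2 ^ 7) x (t x)
   = 239 * (\sum_x e x (t x)) + 120 * #|F| + 209 * #|T| %[mod 256].
  have -> : #|F| = \sum_x (x == t x).
    by rewrite cardsE -sum1_card big_mkcond; apply: eq_bigr => x _; rewrite eq_sym.
  rewrite -[#|T|]sum1_card !big_distrr -!big_split /=.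
  rewrite -modn_summ -[RHS]modn_summ; congr (_ %% _); apply: eq_bigr => x _.
  by rewrite (combo x (t x)) muln1.
case: hG => _ _ _ ->.
(* Squaring modulo 256 six times keeps the unary power from being computed. *)
rewrite -[63.+1]/(2 ^ 6) -modnMmr modn_sqr_iter.
by case: cases => -[-> ->]; vm_compute.
Qed.

Theorem corollary6p1 (T : finType) (e : rel T) (hG : moore_graph_diam2 e 57) :
  odd #|graph_aut e|.
Proof.
rewrite -[odd _]negbK -dvdn2; apply/negP => two_dvd.
have [t /graph_autP e_t ot] := Cauchy (p := 2) (G := graph_aut_group e) isT two_dvd.
have tK : involutive t.
  by move=> x; have := congr1 (fun s : {perm T} => s x) (expg_order t);
  rewrite ot expgS expg1 permM perm1.
by have := no_involution hG e_t tK; move=> t1; rewrite t1 order1 in ot.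
Qed.
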